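(* For any $\delta>0$ there is $L=L(\delta)$ such that $R(g,n)>\big(\tfrac{2}{\sqrt\pi}-\delta\big)\sqrt{gn}$ for all positive integers $g,n$ with $\frac{g}{\log n}>L$ and $\frac ng>L$.
   Context: A set $S$ of integers is a $B^*[g]$ set if for every integer $m$ there are at most $g$ ordered pairs $(s_1,s_2)\in S\times S$ with $s_1+s_2=m$. $R(g,n)$ is the maximum cardinality of a $B^*[g]$ set contained in $\{1,2,\dots,n\}$. *)

(* Defs.v *)
From HB Require Import structures.
From mathcomp Require Import all_boot all_order all_algebra.
From mathcomp Require Import reals exp trigo.
Set Implicit Arguments. Unset Strict Implicit. Unset Printing Implicit Defensive.
Import Order.TTheory GRing.Theory Num.Theory.

(* A set S of integers (here: a subset of {0,...,n}, encoded as {set 'I_n.+1})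
   is a B*[g] set if for every m there are at most g ordered pairs
   (s1,s2) in S x S with s1 + s2 = m.  Since all elements are naturals, all
   sums are naturals, so quantifying over m : nat covers every integer m. *)
Definition isBstar (g n : nat) (S : {set 'I_n.+1}) : bool :=
  [forall m : 'I_(2 * n).+1,
     #|[set p in setX S S | (val p.1 + val p.2 == val m)%N]| <= g]%N.

Definition Rgn (g n : nat) : nat :=
  \max_(S : {set 'I_n.+1} | (S \subset [set i : 'I_n.+1 | 0 < val i]%N)
                            && isBstar g S) #|S|.

(* Main.v *)
(* Put each k in [g, n] into a random set S independently with probability
   sqrt (c / k), where c = (1 - eps) g / pi.  The expected size of S is about
   2 sqrt (c n), i.e. 2 / sqrt pi * sqrt (g n) up to factors close to 1.  The
   number of representations of m is at most 1 + 2 Y, where Y counts the k < m/2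
   with k and m - k both in S; these events are independent for distinct k, and
   E Y <= c * sum_(1 <= k < m/2) 1 / sqrt (k (m - k)) <= c * pi / 2
   = (1 - eps) g / 2,
   the sum being the discrete version of the Beta integral
   int_0^m dx / sqrt (x (m - x)) = pi.  By Chernoff, m has more than g
   representations with probability at most exp (- g eps^2 / 16), which is at
   most n^-2 when g / ln n is large.  A union bound over m then shows that
   discarding the sets that are not B*[g] costs at most O(1) in the expected
   size of S. *)
Require Import Defs.
From HB Require Import structures.
From mathcomp Require Import all_boot all_order all_algebra.
From mathcomp Require Import topology normedtype derive.
From mathcomp Require Import reals sequences exp trigo.
From mathcomp Require Import zify ring lra.
Import Order.TTheory GRing.Theory Num.Theory.
Import numFieldNormedType.Exports.
Local Open Scope ring_scope.

(** * Random subsets with independent membership *)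

(** The probability that the random set equals [S]. Working over any commutative ring keeps the
    identities below purely algebraic. *)
Definition subset_weight {R : comPzRingType} {I : finType} (p : I -> R)
    (S : {set I}) : R :=
  \prod_i (if i \in S then p i else 1 - p i).

Lemma subset_weight_ge0 (R : realDomainType) (I : finType) (p : I -> R)
    (S : {set I}) :
  (forall i, 0 <= p i <= 1) -> 0 <= subset_weight p S.
Proof.
move=> p01; apply: prodr_ge0 => i _; have /andP[p0 p1] := p01 i.
by case: ifP; rewrite ?subr_ge0.
Qed.

(** Deleting the summand [1 - p i] for each [i \in T] from the expanded product of all
    [p i + (1 - p i)] leaves exactly the sets containing [T]. *)
Lemma sum_weight_supset (R : comPzRingType) (I : finType) (p : I -> R)
    (T : {set I}) :
  \sum_(S : {set I} | T \subset S) subset_weight p S = \prod_(i in T) p i.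
Proof.
rewrite big_mkcond [RHS]big_mkcond /=.
transitivity (\prod_i (p i + (if i \in T then 0 else 1 - p i))).
  rewrite bigA_distr; apply: eq_bigr => S _; rewrite /subset_weight.
  case: ifPn => [/subsetP TS|/subsetPn[i iT iS]].
    apply: eq_bigr => i _; case: ifPn => // iS; case: ifPn => // /TS.
    by rewrite (negbTE iS).
  by rewrite (bigD1 i) //= (negbTE iS) iT mul0r.
by apply: eq_bigr => i _; case: ifP; rewrite ?addr0 // addrC subrK.
Qed.

Lemma sum_weight (R : comPzRingType) (I : finType) (p : I -> R) :
  \sum_(S : {set I}) subset_weight p S = 1.
Proof.
rewrite -[RHS](big_set0 _ *%R p) -sum_weight_supset.
by apply: eq_bigl => S; rewrite sub0set.
Qed.

Lemma sum_weight_card (R : comPzRingType) (I : finType) (p : I -> R) :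
  \sum_(S : {set I}) subset_weight p S * #|S|%:R = \sum_i p i.
Proof.
under eq_bigr => S _.
  rewrite -sum1_card natr_sum mulr_sumr big_mkcond /=.
  under eq_bigr => i _ do rewrite mulr1.
  over.
rewrite exchange_big /=; apply: eq_bigr => i _.
rewrite -big_mkcond /= -[RHS](big_set1 *%R) -sum_weight_supset.
by apply: eq_bigl => S; rewrite sub1set.
Qed.

(** * Independence of disjoint pairs and the Chernoff bound *)

Lemma prod_1D (R : comPzRingType) (I : finType) (A : {set I}) (F : I -> R) :
  \prod_(k in A) (1 + F k)
  = \sum_(J : {set I} | J \subset A) \prod_(k in J) F k.
Proof.
rewrite big_mkcond [RHS]big_mkcond /=.
transitivity (\prod_k ((if k \in A then F k else 0) + 1)).
  by apply: eq_bigr => k _; case: ifP; rewrite ?add0r // addrC.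
rewrite bigA_distr; apply: eq_bigr => J _; rewrite -big_mkcond.
case: ifPn => [/subsetP JA|/subsetPn[i iJ iA]].
  by apply: eq_bigr => i iJ; rewrite JA.
by rewrite (bigD1 i) //= (negbTE iA) mul0r.
Qed.

(* Expanding the product over subsets J of A reduces independence of the pairs
   to the probability that S contains the disjoint union of J and sg @: J. *)
Lemma mgf_pairs (R : comPzRingType) (I : finType) (p : I -> R) (A : {set I})
    (sg : I -> I) (s : R) :
  {in A &, injective sg} -> [disjoint A & sg @: A] ->
  \sum_(S : {set I}) subset_weight p S *
     \prod_(k in A) (1 + s * ((k \in S) && (sg k \in S))%:R)
  = \prod_(k in A) (1 + s * (p k * p (sg k))).
Proof.
move=> sgI dis; rewrite prod_1D.
under eq_bigr => S _ do rewrite prod_1D mulr_sumr.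
rewrite exchange_big /=; apply: eq_bigr => J JA.
rewrite big_split /= prodr_const.
have sgJ : {in J &, injective sg}.
  by move=> x y xJ yJ; apply: sgI; apply: (subsetP JA).
have disJ : [disjoint J & sg @: J].
  exact: disjointWl JA (disjointWr (imsetS sg JA) dis).
have -> : \prod_(i in J) (p i * p (sg i)) = \prod_(i in J :|: sg @: J) p i.
  rewrite big_split /= -(big_imset p sgJ) /= -bigU //=.
  by apply: eq_bigl => i; rewrite !inE.
rewrite -sum_weight_supset mulr_sumr [RHS]big_mkcond /=.
apply: eq_bigr => S _; rewrite big_split /= prodr_const.
case: ifPn => [/subsetP JS|].
  rewrite big1 ?mulr1 1?mulrC // => k kJ.
  by rewrite !JS ?inE ?kJ ?imset_f ?orbT.
rewrite subUset negb_and => H.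
suff [k kJ kS] : exists2 k, k \in J & ~~ ((k \in S) && (sg k \in S)).
  by rewrite [X in _ * (_ * X)](bigD1 k) //= (negbTE kS) mul0r !mulr0.
case/orP: H => /subsetPn[k kJ kS]; first by exists k => //; rewrite (negbTE kS).
by case/imsetP: kJ kS => j jJ -> kS; exists j => //; rewrite (negbTE kS) andbF.
Qed.

(** Exponential Markov inequality. Since [1 + (expR t - 1) * b] equals [expR (t * b)] for [b] in {0,
    1}, [mgf_pairs] computes the moment generating function, and [1 + x <= expR x] bounds each
    factor. *)
Lemma tail_pairs (R : realType) (I : finType) (p : I -> R) (A : {set I})
    (sg : I -> I) (t mu a : R) :
  (forall i, 0 <= p i <= 1) ->
  {in A &, injective sg} -> [disjoint A & sg @: A] -> 0 <= t ->
  \sum_(k in A) p k * p (sg k) <= mu ->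
  \sum_(S : {set I} | a <= #|[set k in A | (k \in S) && (sg k \in S)]|%:R)
     subset_weight p S <= expR ((expR t - 1) * mu - t * a).
Proof.
move=> p01 sgI dis t0 pmu.
have s0 : 0 <= expR t - 1 by rewrite subr_ge0 -expR0 ler_expR.
pose Y (S : {set I}) := [set k in A | (k \in S) && (sg k \in S)].
have YE (S : {set I}) :
  \prod_(k in A) (1 + (expR t - 1) * ((k \in S) && (sg k \in S))%:R)
    = expR (t * #|Y S|%:R).
  rewrite expRM_natr -prodr_const [RHS]big_mkcond [LHS]big_mkcond /=.
  apply: eq_bigr => k _; rewrite !inE; case: (k \in A) => //=.
  by case: andb; rewrite ?mulr1 ?mulr0 ?addr0 // addrC subrK.
apply: (@le_trans _ _ (expR (- (t * a)) * \prod_(k in A)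
    (1 + (expR t - 1) * (p k * p (sg k))))).
  rewrite -(mgf_pairs _ _ _ _ _ _ sgI dis) mulr_sumr big_mkcond /=.
  apply: ler_sum => S _; rewrite YE mulrCA -expRD.
  have w0 := subset_weight_ge0 _ _ _ S p01.
  case: ifP => [aY|_]; last by rewrite mulr_ge0 ?expR_ge0.
  rewrite ler_peMr // -[leLHS]expR0 ler_expR addrC -mulrBr mulr_ge0 //.
  by rewrite subr_ge0.
rewrite [X in _ <= expR X]addrC expRD ler_wpM2l ?expR_ge0 //.
apply: (@le_trans _ _ (\prod_(k in A) expR ((expR t - 1) * (p k * p (sg k))))).
  apply: ler_prod => k _; rewrite expR_ge1Dx andbT.
  have /andP[? _] := p01 k; have /andP[? _] := p01 (sg k).
  by rewrite addr_ge0 ?mulr_ge0.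
by rewrite -expR_sum ler_expR -mulr_sumr ler_wpM2l.
Qed.

(** * Representations of [m] as a sum of two elements *)

Definition lower_half (n m : nat) : {set 'I_n.+1} :=
  [set k : 'I_n.+1 | (2 * k < m)%N && (m - k <= n)%N].

(** Every representation with distinct summands is counted by its smaller summand, in two orders;
    the extra 1 is for the diagonal pair (m/2, m/2). *)
Lemma card_repr_le (n m : nat) (S : {set 'I_n.+1}) :
  (#|[set p in setX S S | (val p.1 + val p.2 == m)%N]| <=
   (2 * #|[set k in lower_half n m |
             (k \in S) && (inord (m - k) \in S)]|).+1)%N.
Proof.
set Y := [set k in lower_half n m | _].
pose sg (k : 'I_n.+1) : 'I_n.+1 := inord (m - k).
have sub : [set p in setX S S | (val p.1 + val p.2 == m)%N] \subset
    [set (k, sg k) | k in Y] :|: [set (sg k, k) | k in Y]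
    :|: [set (inord m./2, inord m./2)].
  apply/subsetP => -[a b]; rewrite !inE /= => /andP[/andP[aS bS] /eqP abm].
  have sga : sg a = b by rewrite /sg -abm addKn inord_val.
  have sgb : sg b = a by rewrite /sg -abm addnK inord_val.
  have an := ltn_ord a; have bn := ltn_ord b.
  case: (ltngtP (val a) (val b)) => /= ab.
  - apply/orP; left; apply/orP; left; apply/imsetP; exists a;
      last by rewrite sga.
    by rewrite !inE -/(sg a) sga aS bS /= andbT; apply/andP; split; lia.
  - apply/orP; left; apply/orP; right; apply/imsetP; exists b;
      last by rewrite sgb.
    by rewrite !inE -/(sg b) sgb aS bS /= andbT; apply/andP; split; lia.
  - apply/orP; right; rewrite xpair_eqE -!val_eqE /= !inordK; lia.
apply: leq_trans (subset_leq_card sub) _.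
apply: leq_trans (leq_card_setU _ _) _; rewrite cards1 addn1 ltnS mul2n -addnn.
apply: leq_trans (leq_card_setU _ _) _.
by apply: leq_add; apply: leq_imset_card.
Qed.

Lemma lower_half_inj (n m : nat) :
  {in lower_half n m &, injective (fun k : 'I_n.+1 => inord (m - k) : 'I_n.+1)}.
Proof.
move=> x y; rewrite !inE => /andP[? ?] /andP[? ?] /(congr1 val) /=.
by rewrite !inordK // => ?; apply: val_inj => /=; lia.
Qed.

Lemma lower_half_disjoint (n m : nat) :
  [disjoint lower_half n m &
     (fun k : 'I_n.+1 => inord (m - k) : 'I_n.+1) @: lower_half n m].
Proof.
rewrite -setI_eq0; apply/eqP/setP => x; rewrite in_set0; apply/negP => /setIP[].
rewrite inE => /andP[x1 x2] /imsetP[k]; rewrite inE => /andP[? ?] xk.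
by move: x1; rewrite xk inordK //; lia.
Qed.

(** * The discrete Beta integral *)

(** Mean value theorem, with [sin] increasing up to [pi / 2]. *)
Lemma cos_diff_le (R : realType) (a b : R) :
  0 <= a -> a <= b -> b <= pi / 2 -> cos a - cos b <= (b - a) * sin b.
Proof.
move=> a0 ab bpi.
have [|x xab xE] := @MVT_segment R (@cos R) (fun y => - sin y) a b ab
  (fun y _ => is_derive_cos y).
  exact/continuous_subspaceT/continuous_cos.
have {}xab : a <= x <= b by rewrite in_itv in xab.
have -> : cos a - cos b = sin x * (b - a) by rewrite -opprB xE mulNr opprK.
rewrite mulrC ler_wpM2l ?subr_ge0 // leNgt.
have piE := @pi_gt0 R.
by rewrite ltr_sin ?in_itv /= -?leNgt; lra.
Qed.

Lemma pihalf_itv (R : realType) : 0 <= (pi : R) / 2 <= (pi : R).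
Proof. by have := @pi_gt0 R; lra. Qed.

(* acos (1 - 2 x / m) is an antiderivative of 1 / sqrt (x (m - x)), which is
   decreasing on (0, m / 2]. *)
Lemma sum_inv_sqrt_le_acos (R : realType) (m N : nat) : (0 < m)%N ->
  (2 * N <= m)%N ->
  \sum_(0 <= k < N.+1) (Num.sqrt (k * (m - k))%:R)^-1
    <= acos (1 - 2 * N%:R / m%:R) :> R.
Proof.
move=> m0; elim: N => [|N IH] Nm.
  (* The term [k = 0] is the inverse of 0, which is 0 by convention. *)
  by rewrite big_nat1 mul0n sqrtr0 invr0 mulr0 mul0r subr0 acos1.
rewrite big_nat_recr //=; set u := _^-1.
have Nm1 : (N.+1 < m)%N by lia.
have /IH {IH} : (2 * N <= m)%N by lia.
have mR0 : 0 < m%:R :> R by rewrite ltr0n.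
have NmR : 2 * N.+1%:R <= m%:R :> R by rewrite -natrM ler_nat.
set xa := 1 - 2 * N%:R / m%:R; set xb := 1 - 2 * N.+1%:R / m%:R.
have xab : xa - xb = 2 / m%:R.
  by rewrite /xa /xb -natr1; field; rewrite gt_eqF.
have xb0 : 0 <= xb by rewrite subr_ge0 ler_pdivrMr // mul1r.
have xba : xb <= xa by rewrite -subr_ge0 xab divr_ge0.
have xa1 : xa <= 1 by rewrite gerBl divr_ge0 // ?mulr_ge0 ?ler0n.
have Da : -1 <= xa <= 1 by lra.
have Db : -1 <= xb <= 1 by lra.
have [/andP[a0 api] aE] := acos_def Da.
have [/andP[b0 bpi] bE] := acos_def Db.
have acosM (x y : R) : 0 <= x <= pi -> 0 <= y <= pi -> cos y <= cos x -> x <= y.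
  move=> xpi ypi cyx; rewrite leNgt; apply/negP => yx.
  by move: cyx; rewrite leNgt ltr_cos ?in_itv /= ?xpi ?ypi ?yx.
have ab : acos xa <= acos xb.
  by apply: acosM; rewrite ?a0 ?b0 // aE bE.
have bpi2 : acos xb <= pi / 2.
  apply: acosM => //; rewrite ?b0 //.
    by rewrite pihalf_itv.
  by rewrite bE cos_pihalf.
have := cos_diff_le _ _ _ a0 ab bpi2; rewrite aE bE xab sin_acos //.
(* So the sine of [acos xb] is [2 / m] times the square root in the new term, and the factor [2 / m]
   cancels against [xa - xb]. *)
have -> : 1 - xb ^+ 2 = (2 / m%:R) ^+ 2 * (N.+1 * (m - N.+1))%:R.
  rewrite natrM natrB ?(ltnW Nm1) //.
  move: mR0; rewrite /xb; move: (N.+1%:R) (m%:R) => y z z0.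
  by field; rewrite gt_eqF.
rewrite sqrtrM ?sqr_ge0 // sqrtr_sqr ger0_norm ?divr_ge0 // => H IH.
rewrite -lerBrDl; apply: (@le_trans _ _ (acos xb - acos xa)); last first.
  by rewrite lerB.
have v0 : 0 < Num.sqrt (N.+1 * (m - N.+1))%:R :> R.
  by rewrite sqrtr_gt0 ltr0n muln_gt0 /= subn_gt0.
rewrite /u -div1r ler_pdivrMr //.
have d0 : 0 < 2 / m%:R :> R by rewrite divr_gt0.
by rewrite -(ler_pM2l d0) mulr1 mulrCA.
Qed.

Lemma sum_inv_sqrt_le (R : realType) (m N : nat) : (0 < m)%N ->
  (2 * N <= m)%N ->
  \sum_(0 <= k < N.+1) (Num.sqrt (k * (m - k))%:R)^-1 <= pi / 2 :> R.
Proof.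
move=> m0 Nm; apply: le_trans (sum_inv_sqrt_le_acos R m N m0 Nm) _.
have mR0 : 0 < m%:R :> R by rewrite ltr0n.
have NmR : 2 * N%:R <= m%:R :> R by rewrite -natrM ler_nat.
set x := 1 - _.
have x0 : 0 <= x by rewrite subr_ge0 ler_pdivrMr // mul1r.
have x1 : x <= 1 by rewrite gerBl divr_ge0 // ?mulr_ge0 ?ler0n.
have Dx : -1 <= x <= 1 by lra.
have [/andP[a0 api] aE] := acos_def Dx.
have piE := @pi_gt0 R.
rewrite leNgt; apply/negP.
by rewrite -ltr_cos ?in_itv /= ?a0 // ?cos_pihalf ?aE; lra.
Qed.

(** * From expected size to a lower bound for [Rgn] *)

(** Compared set by set: a B*[g] set avoiding 0 has size at most [Rgn g n], any other set avoiding 0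
    has size at most [n.+1] and at least one bad [m], and a set containing 0 has weight 0. *)
Lemma Rgn_first_moment (R : realType) (g n : nat) (p : 'I_n.+1 -> R) (q : R) :
  (forall i, 0 <= p i <= 1) -> p ord0 = 0 ->
  (forall m : nat, \sum_(S : {set 'I_n.+1} |
     (g < #|[set x in setX S S | (val x.1 + val x.2 == m)%N]|)%N)
     subset_weight p S <= q) ->
  \sum_i p i <= (Rgn g n)%:R + n.+1%:R * ((2 * n).+1%:R * q).
Proof.
move=> p01 p0 tail.
pose bad m (S : {set 'I_n.+1}) :=
  (g < #|[set x in setX S S | (val x.1 + val x.2 == m)%N]|)%N.
apply: (@le_trans _ _ (\sum_(S : {set 'I_n.+1}) subset_weight p S *
  ((Rgn g n)%:R + n.+1%:R * \sum_(m < (2 * n).+1) (bad m S)%:R))); last first.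
  under eq_bigr => S _ do rewrite mulrDr.
  rewrite big_split /= -mulr_suml sum_weight mul1r lerD2l.
  under eq_bigr => S _ do rewrite mulrCA mulr_sumr.
  rewrite -mulr_sumr ler_wpM2l // exchange_big /=.
  apply: (@le_trans _ _ (\sum_(m < (2 * n).+1) q)); last first.
    by rewrite sumr_const card_ord mulr_natl.
  apply: ler_sum => m _; apply: le_trans (tail m); rewrite [leRHS]big_mkcond /=.
  by apply: ler_sum => S _; rewrite /bad; case: ifP; rewrite ?mulr1 ?mulr0.
rewrite -sum_weight_card; apply: ler_sum => S _.
have w0 := subset_weight_ge0 _ _ _ S p01.
have [S0|S0] := boolP (ord0 \in S).
  suff -> : subset_weight p S = 0 by rewrite !mul0r.
  by rewrite /subset_weight (bigD1 ord0) //= S0 p0 mul0r.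
rewrite ler_wpM2l //; have [HS|] := boolP (isBstar g S).
  rewrite ler_wpDr ?mulr_ge0 ?sumr_ge0 // ler_nat.
  apply: (leq_bigmax_cond (F := fun S : {set 'I_n.+1} => #|S|)).
  rewrite HS andbT.
  apply/subsetP => i iS; rewrite inE lt0n; apply: contra S0 => /eqP i0.
  by rewrite (_ : ord0 = i) //; apply: val_inj.
case/forallPn => m; rewrite -ltnNge => mbad.
apply: ler_wpDl => //; apply: (@le_trans _ _ (n.+1%:R * 1)).
  by rewrite mulr1 ler_nat -[n.+1 in X in (_ <= X)%N]card_ord max_card.
rewrite ler_wpM2l // (bigD1 m) //= /bad mbad lerDl.
exact: sumr_ge0.
Qed.

(** * The density and its sums *)

(* Cut off below g, where sqrt (c / k) could exceed 1. *)
Definition density {R : realType} (c : R) (g k : nat) : R :=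
  if (g <= k)%N then Num.sqrt (c / k%:R) else 0.

Lemma density_itv (R : realType) (c : R) (g k : nat) :
  0 <= c <= g%:R -> (0 < g)%N -> 0 <= density c g k <= 1.
Proof.
case/andP=> c0 cg g0; rewrite /density.
case: ifP => gk; last by rewrite lexx ler01.
rewrite sqrtr_ge0 /= -[leRHS]sqrtr1 ler_wsqrtr //.
have k0 : 0 < k%:R :> R by rewrite ltr0n (leq_trans g0).
by rewrite ler_pdivrMr // mul1r (le_trans cg) // ler_nat.
Qed.

Lemma sum_density_ge (R : realType) (c : R) (g N : nat) : 0 <= c ->
  (0 < g <= N)%N ->
  2 * Num.sqrt c * (Num.sqrt N%:R - Num.sqrt g%:R)
    <= \sum_(0 <= k < N) density c g k.
Proof.
move=> c0 /andP[g0]; elim: N => [|N IH]; first by rewrite leqNgt g0.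
rewrite leq_eqVlt ltnS => /predU1P[<-|gN].
  rewrite subrr mulr0; apply: sumr_ge0 => k _; rewrite /density.
  by case: ifP => // _; exact: sqrtr_ge0.
rewrite big_nat_recr //= {2}/density gN.
have {IH} := IH gN; set s := Num.sqrt N%:R; set s1 := Num.sqrt N.+1%:R => IH.
have N0 : 0 < N%:R :> R by rewrite ltr0n (leq_trans g0).
have s0 : 0 < s by rewrite sqrtr_gt0.
have ss1 : s <= s1 by rewrite ler_wsqrtr // ler_nat.
have sE : s ^+ 2 = N%:R by rewrite sqr_sqrtr // ltW.
have s1E : s1 ^+ 2 = N%:R + 1 by rewrite sqr_sqrtr // -natr1.
(* Telescoping: [(s1 - s) * (s1 + s) = 1] and [s1 + s >= 2 * s]. *)
have D : 2 * (s1 - s) <= s^-1.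
  by rewrite -div1r ler_pdivlMr //; nra.
rewrite sqrtrM // sqrtrV ?(ltW N0) // -/s.
have := ler_wpM2l (sqrtr_ge0 c) D.
by move: IH; move: (\sum_(_ <= _ < _) _) (Num.sqrt c) s^-1 => x y z; lra.
Qed.

Lemma sum_density_pairs_le (R : realType) (c : R) (g n m : nat) : 0 <= c ->
  \sum_(k in lower_half n m)
    density c g k * density c g (inord (m - k) : 'I_n.+1)
    <= c * (pi / 2).
Proof.
move=> c0.
have [->|m0] := posnP m.
  rewrite big_pred0 => [|k]; last by rewrite inE ltn0.
  by rewrite mulr_ge0 //; have /andP[] := pihalf_itv R.
have dle k : density c g k <= Num.sqrt (c / k%:R).
  by rewrite /density; case: ifP => // _; rewrite sqrtr_ge0.
have d0 k : 0 <= density c g k.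
  by rewrite /density; case: ifP => // _; rewrite sqrtr_ge0.
have dd (k : 'I_n.+1) : k \in lower_half n m ->
    density c g k * density c g (inord (m - k) : 'I_n.+1)
    <= c * (Num.sqrt (k * (m - k))%:R)^-1.
  rewrite inE => /andP[_ mkn]; rewrite inordK //.
  apply: le_trans (ler_pM (d0 _) (d0 _) (dle _) (dle _)) _.
  rewrite -sqrtrM ?divr_ge0 //.
  have -> : c / k%:R * (c / (m - k)%:R) = c ^+ 2 * ((k * (m - k))%:R)^-1.
    by rewrite mulf_div expr2 natrM.
  by rewrite sqrtrM ?sqr_ge0 // sqrtr_sqr ger0_norm // sqrtrV.
apply: le_trans (ler_sum _ dd) _.
rewrite -mulr_sumr ler_wpM2l //.
pose F k : R := (Num.sqrt (k * (m - k))%:R)^-1.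
have m2 : (2 * m./2 <= m)%N by lia.
apply: le_trans (sum_inv_sqrt_le R m m./2 m0 m2).
(* Both sums are widened to the common range below [M], where they can be compared term by term. *)
rewrite big_mkord; set M := maxn n.+1 m./2.+1.
under eq_bigl => k do rewrite inE.
rewrite (big_ord_widen_cond M (fun k => (2 * k < m)%N && (m - k <= n)%N) F)
  ?leq_maxl //.
rewrite (big_ord_widen_cond M xpredT F) ?leq_maxr //.
rewrite big_mkcond [leRHS]big_mkcond /=; apply: ler_sum => k _.
have F0 : 0 <= F k by rewrite invr_ge0 sqrtr_ge0.
case: ifP => [/andP[/andP[km _] _]|_]; last by case: ifP.
by rewrite ifT //; lia.
Qed.

(** * Tail estimate for the number of representations *)

(** From [expR (- t) >= 1 - t], since [(1 - t) * (1 + t + 2 * t ^+ 2) = 1 + t ^+ 2 * (1 - 2 *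
    t)]. *)
Lemma expR_le_quadratic (R : realType) (t : R) :
  0 <= t <= 1 / 2 -> expR t <= 1 + t + 2 * t ^+ 2.
Proof.
move=> /andP[t0 t1]; have := expR_ge1Dx (- t); rewrite expRN => H.
have e0 := expR_gt0 t.
have : (1 - t) * expR t <= 1 by rewrite -ler_pdivlMr // div1r.
have : 1 <= (1 - t) * (1 + t + 2 * t ^+ 2) by nra.
by move: (expR t) => x H1 H2; rewrite -(@ler_pM2l _ (1 - t)); lra.
Qed.

Lemma tail_repr (R : realType) (g n m : nat) (eps : R) :
  (0 < g)%N -> 0 < eps <= 1 / 2 ->
  \sum_(S : {set 'I_n.+1} |
     (g < #|[set x in setX S S | (val x.1 + val x.2 == m)%N]|)%N)
     subset_weight (fun k : 'I_n.+1 => density ((1 - eps) * g%:R / pi) g k) S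
  <= expR (- (g%:R * eps ^+ 2 / 16)).
Proof.
move=> g0 /andP[e0 e1]; set c := (1 - eps) * g%:R / pi.
have pi2 := @pi_ge2 R.
have gR : 0 < g%:R :> R by rewrite ltr0n.
have c0 : 0 <= c by rewrite /c !mulr_ge0 ?invr_ge0 ?pi_ge0 //; lra.
have cg : c <= g%:R by rewrite /c ler_pdivrMr ?pi_gt0 //; nra.
have p01 (k : 'I_n.+1) : 0 <= density c g k <= 1.
  by apply: density_itv => //; rewrite c0.
(* With [t = eps / 4], [mu = (1 - eps) * g / 2] and [a = g / 2], the Chernoff exponent is at most
   [- g * (eps ^+ 2 + eps ^+ 3) / 16]. *)
have t0 : 0 <= eps / 4 by lra.
have T := tail_pairs _ _ _ _ _ _ _ (g%:R / 2) p01 (lower_half_inj n m)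
  (lower_half_disjoint n m) t0 (sum_density_pairs_le R c g n m c0).
apply: le_trans (le_trans T _).
  rewrite big_mkcond [leRHS]big_mkcond /=; apply: ler_sum => S _.
  have w0 := subset_weight_ge0 _ _ _ S p01.
  case: ifP => [gr|_]; last by case: ifP.
  (* More than [g] representations and at most [2 * Y + 1] of them force [Y >= g / 2]. *)
  rewrite ifT // ler_pdivrMr // -natrM ler_nat.
  by have := leq_trans gr (card_repr_le n m S); rewrite ltnS mulnC.
rewrite ler_expR.
have -> : c * (pi / 2) = (1 - eps) * g%:R / 2.
  by rewrite mulrA divfK // gt_eqF ?pi_gt0.
have H : expR (eps / 4) <= 1 + eps / 4 + 2 * (eps / 4) ^+ 2.
  by apply: expR_le_quadratic; apply/andP; split; lra.
move: H gR; move: (expR _) (g%:R) => x y H y0.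
have : (x - 1) * ((1 - eps) * y / 2)
    <= (eps / 4 + 2 * (eps / 4) ^+ 2) * ((1 - eps) * y / 2).
  by apply: ler_wpM2r; [nra | lra].
have : 0 <= y * eps ^+ 2 * eps by rewrite !mulr_ge0 ?sqr_ge0 // ltW.
by lra.
Qed.

(** * Explicit lower bound and choice of constants *)

(** The cutoff below [g] costs [2 * g], the bad sets cost 6 because
    [(n + 1) * (2 * n + 1) <= 6 * n ^+ 2], and [sqrt (1 - eps)] is replaced by the smaller
    [1 - eps]. *)
Lemma Rgn_ge (R : realType) (g n : nat) (eps : R) :
  (0 < g <= n)%N -> 0 < eps <= 1 / 2 ->
  n%:R ^- 2 >= expR (- (g%:R * eps ^+ 2 / 16)) ->
  2 / Num.sqrt pi * (1 - eps) * Num.sqrt (g%:R * n%:R) - 2 * g%:R - 6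
    <= (Rgn g n)%:R :> R.
Proof.
move=> /andP[g0 gn] He Hq; have /andP[e0 e1] := He.
set c := (1 - eps) * g%:R / pi.
have pi2 := @pi_ge2 R.
have gR : 0 < g%:R :> R by rewrite ltr0n.
have nR : 1 <= n%:R :> R by rewrite ler1n (leq_trans g0).
have c0 : 0 <= c by rewrite /c !mulr_ge0 ?invr_ge0 ?pi_ge0 //; lra.
have cg : c <= g%:R by rewrite /c ler_pdivrMr ?pi_gt0 //; nra.
have p01 (k : 'I_n.+1) : 0 <= density c g k <= 1.
  by apply: density_itv => //; rewrite c0.
have p0 : density c g (@ord0 n) = 0.
  by rewrite /density leqNgt g0.
have := Rgn_first_moment R g n _ _ p01 p0
  (fun m => tail_repr R g n m eps g0 He).
have := sum_density_ge R c g n.+1 c0; rewrite big_mkord g0 leqW // => /(_ isT).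
set q := expR _ in Hq *; set s := \sum_(k < _) _ => Hs HR.
have err : n.+1%:R * ((2 * n).+1%:R * q) <= 6.
  apply: (@le_trans _ _ (n.+1%:R * ((2 * n).+1%:R * n%:R ^- 2))).
    by rewrite !ler_wpM2l.
  rewrite mulrA ler_pdivrMr ?exprn_gt0 //; last by lra.
  by rewrite -!natr1 natrM; nra.
have main : 2 * Num.sqrt c * (Num.sqrt n.+1%:R - Num.sqrt g%:R) >=
  2 / Num.sqrt pi * (1 - eps) * Num.sqrt (g%:R * n%:R) - 2 * g%:R; last by lra.
have n1 : Num.sqrt n%:R <= Num.sqrt n.+1%:R :> R by rewrite ler_wsqrtr ?ler_nat.
have sc : Num.sqrt c * Num.sqrt g%:R <= g%:R.
  apply: (@le_trans _ _ (Num.sqrt g%:R * Num.sqrt g%:R)).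
    by rewrite ler_wpM2r ?sqrtr_ge0 // ler_wsqrtr.
  by rewrite -expr2 sqr_sqrtr // ltW.
have cE : Num.sqrt c = Num.sqrt (1 - eps) * Num.sqrt g%:R / Num.sqrt pi.
  rewrite /c sqrtrM ?sqrtrV ?pi_ge0 ?sqrtrM //; first by lra.
  by rewrite mulr_ge0 //; lra.
have se : 1 - eps <= Num.sqrt (1 - eps).
  rewrite -[leLHS]ger0_norm -?sqrtr_sqr; last by lra.
  by rewrite ler_wsqrtr //; nra.
have Hc : 1 / Num.sqrt pi * (1 - eps) * Num.sqrt (g%:R * n%:R)
     <= Num.sqrt c * Num.sqrt n.+1%:R.
  rewrite cE sqrtrM // mulrA.
  apply: ler_pM; rewrite ?mulr_ge0 ?invr_ge0 ?sqrtr_ge0 //; first by lra.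
  rewrite [leRHS]mulrAC ler_wpM2r ?sqrtr_ge0 // div1r mulrC.
  by rewrite ler_wpM2r ?invr_ge0 ?sqrtr_ge0.
by lra.
Qed.

Theorem theorem3p9 (R : realType) (delta : R) (hdelta : 0 < delta) :
  exists L : R, forall g n : nat, (0 < g)%N -> (0 < n)%N ->
    g%:R / ln (n%:R : R) > L -> n%:R / g%:R > L ->
    (Rgn g n)%:R > (2 / Num.sqrt pi - delta) * Num.sqrt (g%:R * n%:R).
Proof.
(* [eps <= 1 / 2] serves the tail bound; [eps <= delta / 4] keeps the loss in the main term below
   [delta / 2 * s]. *)
pose eps : R := Num.min (delta / 4) (1 / 2).
have e0 : 0 < eps by rewrite lt_min; apply/andP; split; lra.
have e12 : eps <= 1 / 2 by rewrite ge_min lexx orbT.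
have ed : eps <= delta / 4 by rewrite ge_min lexx.
(* With [L = y ^+ 2], the bound [y * delta >= 16] absorbs [2 * g + 6], and [y * eps >= 6] makes the
   tail at most [n ^- 2], as 36 / 16 >= 2. *)
pose y : R := 16 / delta + 6 / eps + 1.
have y1 : 1 <= y by rewrite lerDr addr_ge0 ?divr_ge0 // ltW.
have yd : 16 <= y * delta.
  have -> : y * delta = 16 + 6 * (delta / eps) + delta.
    by rewrite /y; field; rewrite !gt_eqF.
  by have := divr_gt0 hdelta e0; lra.
have ye : 6 <= y * eps.
  have -> : y * eps = 6 + 16 * (eps / delta) + eps.
    by rewrite /y; field; rewrite !gt_eqF.
  by have := divr_gt0 e0 hdelta; lra.
exists (y ^+ 2) => g n g0 n0 Hg Hn.
have gR : 1 <= g%:R :> R by rewrite ler1n.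
have nR : 1 <= n%:R :> R by rewrite ler1n.
have y21 : 1 <= y ^+ 2 by rewrite exprn_ege1.
rewrite ltr_pdivlMr in Hn; last by lra.
have gn : (g <= n)%N by rewrite -(ler_nat R); nra.
(* For [n = 1] the quotient [g / ln n] would be 0 by convention, contradicting [Hg]. *)
have ln0 : 0 < ln (n%:R : R).
  rewrite lt_neqAle ln_ge0 // andbT eq_sym; apply/eqP => l0.
  by move: Hg; rewrite l0 invr0 mulr0; lra.
rewrite ltr_pdivlMr // in Hg.
have /(Rgn_ge R g n) H : 0 < eps <= 1 / 2 by rewrite e0.
have {H} := H _; rewrite g0 gn => /(_ isT).
have Hq : expR (- (g%:R * eps ^+ 2 / 16)) <= n%:R ^- 2.
  have -> : n%:R ^- 2 = expR (- (2 * ln (n%:R : R))).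
    by rewrite expRN expRM_natl lnK // posrE; lra.
  rewrite ler_expR lerN2 ler_pdivlMr //.
  have : 36 <= (y * eps) ^+ 2.
    by apply: le_trans (_ : 6 ^+ 2 <= _); [lra | rewrite lerXn2r ?nnegrE; lra].
  rewrite exprMn => H.
  have : y ^+ 2 * ln (n%:R : R) * eps ^+ 2 <= g%:R * eps ^+ 2.
    by rewrite ler_wpM2r ?sqr_ge0 // ltW.
  have := ler_wpM2r (ltW ln0) H.
  by lra.
move/(_ Hq); set s := Num.sqrt (g%:R * n%:R).
have sE : s ^+ 2 = g%:R * n%:R by rewrite sqr_sqrtr ?mulr_ge0.
have s0 : 0 <= s by rewrite sqrtr_ge0.
have gy : g%:R * y < s.
  rewrite -(@ltr_pXn2r _ 2) ?nnegrE ?mulr_ge0 //; last by lra.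
  by rewrite sE exprMn expr2 -mulrA ltr_pM2l; lra.
(* [2 * g + 6 <= 8 * g <= delta / 2 * (g * y)], and [g * y < s]. *)
have small : 2 * g%:R + 6 < delta / 2 * s by nra.
have spi : 1 <= Num.sqrt pi :> R.
  by rewrite -[leLHS]sqrtr1 ler_wsqrtr //; have := @pi_ge2 R; lra.
have ip : 2 / Num.sqrt pi * eps <= delta / 2.
  apply: (@le_trans _ _ (2 * eps)); last by lra.
  rewrite ler_wpM2r ?(ltW e0) // ler_pdivrMr; lra.
have := ler_wpM2r s0 ip.
by lra.
Qed.
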